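(* Let $\mathcal{A}$ be an $m$th order, $n$ dimensional tensor, with reduced matrix $Q_{\mathcal{A}}$, and for each integer $\alpha\ge 0$ let $A^{(\alpha)}$ denote the mode-$1$ matricization of the power $\mathcal{A}^\alpha$. Then, for any integers $\alpha,\beta\ge 0$, $$A^{(\alpha+\beta)}=A^{(\alpha)}Q_{\mathcal{A}}^{\beta}.$$
   Context: Throughout, $m,n\ge 2$ are integers and $\langle n\rangle=\{1,2,\ldots,n\}$. An $m$th order, $n$ dimensional tensor $\mathcal{A}=[a_{i_1i_2\ldots i_m}]$ is an array of real numbers indexed by $i_1,\ldots,i_m\in\langle n\rangle$. Box product: for $m$th order, $n$ dimensional tensors $\mathcal{A}=[a_{i_1\ldots i_m}]$ and $\mathcal{B}=[b_{i_1\ldots i_m}]$, the tensor $\mathcal{C}=\mathcal{A}\boxtimes\mathcal{B}$ is the $m$th order, $n$ dimensional tensor with entries $$c_{i_1i_2\ldots i_m}=\sum_{j\in\langle n\rangle}a_{i_1ji_2\ldots i_{m-1}}\,b_{ji_2\ldots i_m},\quad i_1,\ldots,i_m\in\langle n\rangle$$ (for $m=2$ this is matrix multiplication; for $m\ge3$ it is in general not associative). Powers: $\mathcal{A}^0=\mathcal{I}$, where $\mathcal{I}=[\delta_{i_1i_2\ldots i_m}]$ is the identity tensor with $\delta_{i_1i_2\ldots i_m}=\delta_{i_1i_2}$ (Kronecker delta of the first two indices); $\mathcal{A}^1=\mathcal{A}$; and $\mathcal{A}^\alpha=\mathcal{A}^{\alpha-1}\boxtimes\mathcal{A}$ for $\alpha\ge2$.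 Write $\mathcal{A}^\alpha=[a^{(\alpha)}_{i_1i_2\ldots i_m}]$. Multi-indices: $\langle n\rangle^{m-1}$ is the set of multi-indices $i_1i_2\ldots i_{m-1}$ with each $i_j\in\langle n\rangle$; these index rows/columns of matrices of size $N=n^{m-1}$, always in the linear indexing order (first index varying fastest). Mode-$1$ matricization: for an $m$th order, $n$ dimensional tensor with entries $b_{i_1\ldots i_m}$, it is the $n\times N$ matrix whose entry in row $i_1\in\langle n\rangle$ and column $i_2i_3\ldots i_m\in\langle n\rangle^{m-1}$ is $b_{i_1i_2\ldots i_m}$. Thus $A^{(\alpha)}$ has entries $a^{(\alpha)}_{i_1,i_2\ldots i_m}=a^{(\alpha)}_{i_1i_2\ldots i_m}$; in particular $A^{(0)}$ has entries $\delta_{i_1i_2}$. Reduced matrix: $Q_{\mathcal{A}}$ is the $N\times N$ matrix, $N=n^{m-1}$, whose entry in row $i_1i_2\ldots i_{m-1}\in\langle n\rangle^{m-1}$ and column $j_2j_3\ldots j_m\in\langle n\rangle^{m-1}$ is $$q_{i_1i_2\ldots i_{m-1},\,j_2j_3\ldots j_m}=\begin{cases}a_{i_1i_2\ldots i_{m-1}j_m}, & i_\ell=j_\ell \text{ for } \ell=2,3,\ldots,m-1,\\ 0,&\text{otherwise.}\end{cases}$$ For $\beta=0$, $Q_{\mathcal{A}}^0$ is the $N\times N$ identity matrix. *)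

(* Defs.v *)
From HB Require Import structures.
From mathcomp Require Import all_boot all_order all_algebra.
From mathcomp Require Import reals.

Set Implicit Arguments.
Unset Strict Implicit.
Unset Printing Implicit Defensive.

Import GRing.Theory.
Local Open Scope ring_scope.

(* Indices are 0-based: 'I_n stands for {1, ..., n}.  Tensors of order at least
   2 are written as tensors of order m.+2, so that their matricizations have
   n ^ m.+1 columns. *)

Definition tensor (R : Type) (m n : nat) := {ffun m.-tuple 'I_n -> R}.

Definition belast_index (n p : nat) (t : p.+1.-tuple 'I_n) : p.-tuple 'I_n :=
  [tuple tnth t (widen_ord (leqnSn p) l) | l < p].

(* c_(i_1 ... i_m) = \sum_j a_(i_1 j i_2 ... i_(m-1)) * b_(j i_2 ... i_m) *)
Definition boxprod (R : realType) (m n : nat) (A B : tensor R m.+2 n) :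
    tensor R m.+2 n :=
  [ffun i : m.+2.-tuple 'I_n =>
    let t : m.+1.-tuple 'I_n := behead_tuple i in
    \sum_(j < n)
      A (cons_tuple (thead i) (cons_tuple j (belast_index t)))
        * B (cons_tuple j t)].

Definition idtensor (R : realType) (m n : nat) : tensor R m.+2 n :=
  [ffun i : m.+2.-tuple 'I_n => (tnth i ord0 == tnth i (lift ord0 ord0))%:R].

Fixpoint tpow (R : realType) (m n : nat) (A : tensor R m.+2 n) (a : nat) :
    tensor R m.+2 n :=
  match a with
  | 0 => idtensor R m n
  | 1 => A
  | a'.+1 => boxprod (tpow A a') A
  end.

Lemma digit_subproof (n p : nat) (k : 'I_(n ^ p)) (l : 'I_p) :
  ((k %/ n ^ l) %% n < n)%N.
Proof.
rewrite ltn_mod; case: n k => // k.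
by case: p k l => [|p] k l; [case: l | move: k; rewrite exp0n // => -[]].
Qed.

(* The linear indexing order on multi-indices of length p, first index varying
   fastest: k is sent to the (i_0, ..., i_(p-1)) with k = \sum_l i_l * n ^ l. *)
Definition multi_index (n p : nat) (k : 'I_(n ^ p)) : p.-tuple 'I_n :=
  [tuple Ordinal (digit_subproof k l) | l < p].

Definition mode1 (R : realType) (m n : nat) (B : tensor R m.+2 n) :
    'M[R]_(n, n ^ m.+1) :=
  \matrix_(i < n, k < n ^ m.+1) B (cons_tuple i (multi_index k)).

(* In row i_1 ... i_(m-1) and column j_2 ... j_m, the condition
   i_l = j_l for 2 <= l <= m - 1 says that dropping the first entry of the
   row multi-index and the last entry of the column one gives the same. *)
Definition reduced_mx (R : realType) (m n : nat) (A : tensor R m.+2 n) :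
    'M[R]_(n ^ m.+1) :=
  \matrix_(r < n ^ m.+1, c < n ^ m.+1)
    let u : m.+1.-tuple 'I_n := multi_index r in
    let v : m.+1.-tuple 'I_n := multi_index c in
    if behead_tuple u == belast_index v
    then A (rcons_tuple u (tnth v ord_max))
    else 0.

(* Main.v *)
Require Import Defs.
From mathcomp Require Import all_boot all_order all_algebra.
From mathcomp Require Import reals.

Import GRing.Theory.
Local Open Scope ring_scope.

(* It suffices that right multiplication by Q_A turns the matricization of B
   into that of the box product of B and A: in column v, the nonzero entries of
   Q_A lie in the n rows (j, v_1, ..., v_(m-2)), where they equal a_(j v), so
   the matrix product is the sum over j which defines the box product. *)

(** Uniqueness of base-[n] expansions: the digit at [l = 0] is the remainder mod [n], and the
    quotients by [n] carry the other digits, shifted by one. *)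
Lemma eq_digits (n p k k' : nat) : (k < n ^ p)%N -> (k' < n ^ p)%N ->
  (forall l, (l < p)%N -> (k %/ n ^ l) %% n = (k' %/ n ^ l) %% n)%N -> k = k'.
Proof.
elim: p k k' => [|p IHp] k k'; first by rewrite expn0 !ltnS !leqn0 => /eqP-> /eqP->.
have [->|n_gt0 ltk ltk' eq_kk'] := posnP n; first by rewrite exp0n.
rewrite (divn_eq k n) (divn_eq k' n); have := eq_kk' 0%N isT; rewrite expn0 !divn1 => ->.
congr (_ * _ + _)%N; apply: IHp; rewrite ?ltn_divLR -?expnSr // => l ltlp.
by rewrite -!divnMA -expnS eq_kk'.
Qed.

(** Lets a sum over linear indices be rewritten as a sum over tuples. *)
Lemma multi_index_bij (n p : nat) : bijective (@multi_index n p).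
Proof.
apply: inj_card_bij => [k k' eq_kk'|]; last by rewrite card_tuple !card_ord.
apply/val_inj/(@eq_digits n p) => [||l ltlp]; try exact: ltn_ord.
have /(congr1 val) := congr1 (fun t => tnth t (Ordinal ltlp)) eq_kk'.
by rewrite !tnth_mktuple.
Qed.

Lemma rcons_belast_index (n p : nat) (t : p.+1.-tuple 'I_n) :
  rcons (belast_index t) (tnth t ord_max) = t.
Proof.
apply: (@eq_from_nth _ (tnth t ord_max)) => [|l].
  by rewrite size_rcons !size_tuple.
rewrite size_rcons size_tuple ltnS nth_rcons size_tuple leq_eqVlt => lep.
have [ltlp|gtlp|->] := ltngtP l p; last by rewrite [LHS](tnth_nth (tnth t ord_max)).
- have := tnth_nth (tnth t ord_max) (belast_index t) (Ordinal ltlp).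
  by rewrite tnth_mktuple (tnth_nth (tnth t ord_max)) => <-.
- by move: lep; rewrite -leq_eqVlt leqNgt gtlp.
Qed.

Lemma mode1_boxprod (R : realType) (m n : nat) (B A : tensor R m.+2 n) :
  mode1 (boxprod B A) = mode1 B *m reduced_mx A.
Proof.
apply/matrixP => i k; rewrite !mxE ffunE /=.
set v := multi_index k.
(* [F u] is the term of the matrix product at the row of [reduced_mx A] with multi-index [u]. *)
pose F (u : m.+1.-tuple 'I_n) := B (cons_tuple i u) *
  (if behead_tuple u == belast_index v
   then A (rcons_tuple u (tnth v ord_max)) else 0).
transitivity (\sum_u F u); last first.
  rewrite (reindex (@multi_index n m.+1)); last exact/onW_bij/multi_index_bij.
  by apply: eq_bigr => r _; rewrite !mxE.
rewrite (bigID (fun u : m.+1.-tuple 'I_n => behead_tuple u == belast_index v)) /=.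
rewrite [X in _ = _ + X]big1 => [|u /negPf neq_u]; last by rewrite /F neq_u mulr0.
(* A surviving [u] has its tail prescribed by [v], so its head [j] is the only free parameter. *)
rewrite addr0 (reindex (fun j => cons_tuple j (belast_index v))) /=; last first.
  exists (fun u : m.+1.-tuple 'I_n => thead u) => [j _|u]; first by rewrite theadE.
  by rewrite inE => /eqP <-; rewrite [RHS]tuple_eta; apply: val_inj.
have beheadK j : behead_tuple (cons_tuple j (belast_index v)) = belast_index v.
  exact: val_inj.
have beheadKv : behead_tuple (cons_tuple i v) = v by exact: val_inj.
apply: eq_big => [j|j _]; first by rewrite beheadK eqxx.
rewrite /F beheadK eqxx theadE beheadKv; congr (_ * A _).
by apply: val_inj; rewrite /= rcons_belast_index.
Qed.

(** The Kronecker delta compares the first index with the summation index [j], so one term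
    survives. *)
Lemma boxprod_idtensor (R : realType) (m n : nat) (A : tensor R m.+2 n) :
  boxprod (idtensor R m n) A = A.
Proof.
apply/ffunP => t; rewrite ffunE /= (bigD1 (thead t)) //= big1 => [|j neq_j].
  rewrite ffunE !(tnth_nth (thead t)) /= eqxx mul1r addr0.
  by rewrite [in RHS](tuple_eta t); congr (A _); apply: val_inj.
by rewrite ffunE !(tnth_nth (thead t)) /= eq_sym (negPf neq_j) mul0r.
Qed.

(* The powers satisfy the recursion from exponent 0 on, although they are
   defined with a separate case at exponent 1. *)
Lemma tpowS (R : realType) (m n : nat) (A : tensor R m.+2 n) (a : nat) :
  tpow A a.+1 = boxprod (tpow A a) A.
Proof. by case: a => [|a] //=; rewrite boxprod_idtensor. Qed.

Theorem theorem2p5 (R : realType) (m n : nat) (hn : (1 < n)%N)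
    (A : tensor R m.+2 n) (a b : nat) :
  mode1 (tpow A (a + b)) = mode1 (tpow A a) *m reduced_mx A ^+ b.
Proof.
(* Each new factor [A] enters on the right, so only matrix products get reassociated, never box
   products. *)
elim: b => [|b IHb]; first by rewrite addn0 expr0 mulmx1.
by rewrite addnS tpowS mode1_boxprod IHb exprSr -mulmxA.
Qed.
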